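(* The integrality gap of the semidefinite program $\mathrm{SDP}_1$ (the Povh–Rendl QAP relaxation specialized to the traveling salesman problem, defined in the context) is unbounded; that is, $$\sup_{D\in\mathcal{D}} \frac{\mathrm{OPT}_{\mathrm{TSP}}(D)}{\mathrm{OPT}_{\mathrm{SDP}_1}(D)}=+\infty .$$
   Context: TSP: an instance on $n$ vertices is a symmetric matrix $D=(d_{ij})\in\mathbb{R}^{n\times n}$ with $d_{ij}\ge 0$, $d_{ii}=0$ and $d_{ij}\le d_{ik}+d_{kj}$ for all $i,j,k$ (distinct vertices may be at distance $0$). $\mathcal{D}$ is the set of all such matrices, over all $n\ge 3$. $\mathrm{OPT}_{\mathrm{TSP}}(D)$ is the minimum total cost of a Hamiltonian cycle in $K_n$ with edge costs $d_{ij}$. Notation: $I_m$, $J_m$ are the $m\times m$ identity and all-ones matrices; $E^{(m)}_{jj}$ is the $m\times m$ matrix with a single $1$ in position $(j,j)$; $\mathbb{S}^{m\times m}$ is the set of real symmetric $m\times m$ matrices; $\otimes$ is the Kronecker product; $Y\ge 0$ is entrywise and $Y\succeq 0$ means positive semidefinite. $C^{(n)}_1$ is the adjacency matrix of the $n$-cycle with edges $\{i,i+1\}$ and $\{n,1\}$. $\mathrm{SDP}_1$: $\mathrm{OPT}_{\mathrm{SDP}_1}(D)$ is the minimum of $\tfrac12\mathrm{trace}\big((D\otimes C^{(n)}_1)Y\big)$ over $Y\in\mathbb{S}^{n^2\times n^2}$ with $Y\ge 0$, $Y\succeq 0$ and (i) $\mathrm{trace}((I_n\otimes E^{(n)}_{jj})Y)=1$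 for $j=1,\dots,n$; (ii) $\mathrm{trace}((E^{(n)}_{jj}\otimes I_n)Y)=1$ for $j=1,\dots,n$; (iii) $\mathrm{trace}\big((I_n\otimes(J_n-I_n)+(J_n-I_n)\otimes I_n)Y\big)=0$; (iv) $\mathrm{trace}(J_{n^2}Y)=n^2$. In the supremum, instances with $\mathrm{OPT}_{\mathrm{TSP}}(D)=0$ are disregarded, and a ratio with positive numerator and zero denominator is read as $+\infty$. *)

(* Defs.v *)
From HB Require Import structures.
From mathcomp Require Import all_boot all_order all_algebra.
From mathcomp Require Import mxtens.
From mathcomp Require Import all_classical all_reals ereal.

Set Implicit Arguments.
Unset Strict Implicit.
Unset Printing Implicit Defensive.

Import Order.TTheory GRing.Theory Num.Theory.
Local Open Scope classical_set_scope.
Local Open Scope ring_scope.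

Section Defs.
Context {R : realType}.

Definition tsp_instance n (D : 'M[R]_n) : Prop :=
  [/\ D^T = D,
      forall i j, 0 <= D i j,
      forall i, D i i = 0
    & forall i j k, D i j <= D i k + D k j].

(* A Hamiltonian cycle of K_n, given by the sequence in which it visits its
   vertices: a simple cycle for the adjacency relation of K_n that has n
   vertices. *)
Definition hamiltonian_cycle n (c : seq 'I_n) : Prop :=
  ucycle (fun i j : 'I_n => i != j) c /\ size c = n.

Definition cycle_cost n (D : 'M[R]_n) (c : seq 'I_n) : R :=
  \sum_(i <- c) D i (next c i).

(* The optimal values are extended reals, so that the infimum of an empty set
   is +oo and not a conventional real number. *)
Definition opt_tsp n (D : 'M[R]_n) : \bar R :=
  ereal_inf [set (cycle_cost D c)%:E | c in [set c | hamiltonian_cycle c]].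

Definition psdmx m (Y : 'M[R]_m) : Prop :=
  Y^T = Y /\ forall x : 'cV[R]_m, 0 <= (x^T *m Y *m x) 0 0.

(* [ordS] is the successor modulo n, so this is the adjacency matrix of the
   n-cycle when 3 <= n. *)
Definition cycle_mx n : 'M[R]_n :=
  \matrix_(i, j) ((j == ordS i) || (i == ordS j))%:R.

Definition all_ones m : 'M[R]_m := const_mx 1.

Definition sdp1_feasible n (Y : 'M[R]_(n * n)) : Prop :=
  [/\ Y^T = Y, (forall a b, 0 <= Y a b) & psdmx Y] /\
  [/\ forall j : 'I_n, \tr (tensmx (1%:M : 'M_n) (delta_mx j j : 'M_n) *m Y) = 1,
      forall j : 'I_n, \tr (tensmx (delta_mx j j : 'M_n) (1%:M : 'M_n) *m Y) = 1,
      \tr ((tensmx 1%:M (all_ones n - 1%:M)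
            + tensmx (all_ones n - 1%:M) 1%:M) *m Y) = 0
    & \tr (all_ones (n * n) *m Y) = (n ^ 2)%N%:R].

Definition sdp1_cost n (D : 'M[R]_n) (Y : 'M[R]_(n * n)) : R :=
  2^-1 * \tr (tensmx D (cycle_mx n) *m Y).

Definition opt_sdp1 n (D : 'M[R]_n) : \bar R :=
  ereal_inf [set (sdp1_cost D Y)%:E | Y in [set Y | sdp1_feasible Y]].

End Defs.

(* Main.v *)
(* Take n = 2m points in two clusters of size m, at distance 0 inside a cluster
   and 1 across; every tour pays at least 1.  Let D be this cut metric and put
   H p q = (1 - cos ((p - q) pi / m)) / 2, so that D and H are symmetric with
   zero diagonal, entries in [0, 1] and row sums m.  The matrix
     Y = (I (x) I + (J-I-D) (x) (J-I-H) / (m-1) + D (x) H / m) / n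
   is feasible, and its cost is m (1 - cos (pi / m)), which tends to 0.  In the
   eigenbasis of D,
     n Y = J/n (x) J + (J-2D)/n (x) (J-2H) + P (x) (m I - (J-H)) / (m-1),
   where P is the complementary projection, J-2D and J-2H are Gram matrices and
   m I - (J-H) is a weighted graph Laplacian; hence Y is positive
   semidefinite. *)
Require Import Defs.
From mathcomp Require Import all_boot all_order all_algebra.
From mathcomp Require Import mxtens ring lra.
From mathcomp Require Import all_classical all_reals ereal.
From mathcomp Require Import normedtype derive trigo.

Set Implicit Arguments.
Unset Strict Implicit.
Unset Printing Implicit Defensive.

Import Order.TTheory GRing.Theory Num.Theory.
Import numFieldNormedType.Exports.

Local Open Scope ring_scope.

(** * Traces and Kronecker products *)

Section KroneckerTrace.
Context {R : comPzRingType}.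

Lemma sum_mxtens_index m n (F : 'I_(m * n) -> R) :
  \sum_k F k = \sum_i \sum_j F (mxtens_index (i, j)).
Proof.
rewrite pair_big /= (reindex (@mxtens_index m n)) /=.
  by apply: eq_bigr => -[i j] _.
by exists (@mxtens_unindex m n) => k _; rewrite ?mxtens_indexK ?mxtens_unindexK.
Qed.

Lemma mxtrace_tens m n (A : 'M[R]_m) (B : 'M[R]_n) :
  \tr (tensmx A B) = \tr A * \tr B.
Proof.
rewrite /mxtrace sum_mxtens_index mulr_suml; apply: eq_bigr => i _.
by rewrite mulr_sumr; apply: eq_bigr => j _; rewrite tensmxE.
Qed.

Lemma mxtrace_mulE m n (A : 'M[R]_(m, n)) (B : 'M[R]_(n, m)) :
  \tr (A *m B) = \sum_i \sum_j A i j * B j i.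
Proof. by apply: eq_bigr => i _; rewrite mxE. Qed.

Lemma mxtrace_mul_eq0 n (A B : 'M[R]_n) :
  (forall i j, A i j * B j i = 0) -> \tr (A *m B) = 0.
Proof.
by move=> AB0; rewrite mxtrace_mulE big1 // => i _; rewrite big1.
Qed.

Lemma mxtrace_delta_mul n (A : 'M[R]_n) j : \tr (delta_mx j j *m A) = A j j.
Proof.
rewrite mxtrace_mulE (bigD1 j) //= [X in _ + X]big1 => [|i /negPf ij].
  rewrite addr0 (bigD1 j) //= big1 => [|k /negPf kj].
    by rewrite !mxE !eqxx mul1r addr0.
  by rewrite !mxE kj andbF mul0r.
by rewrite big1 // => k _; rewrite !mxE ij mul0r.
Qed.

End KroneckerTrace.

(** * Constructions of positive semidefinite matrices *)

Section PositiveSemidefinite.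
Context {R : realType}.

Lemma quad_formE n (Y : 'M[R]_n) (x : 'cV_n) :
  (x^T *m Y *m x) 0 0 = \sum_i \sum_j x i 0 * Y i j * x j 0.
Proof.
rewrite mxE exchange_big /=; apply: eq_bigr => j _; rewrite mxE mulr_suml.
by apply: eq_bigr => i _; rewrite !mxE.
Qed.

Lemma psdmxD n (A B : 'M[R]_n) : psdmx A -> psdmx B -> psdmx (A + B).
Proof.
move=> [At A0] [Bt B0]; split; first by rewrite linearD /= At Bt.
by move=> x; rewrite mulmxDr mulmxDl mxE addr_ge0.
Qed.

Lemma psdmxZ n a (A : 'M[R]_n) : 0 <= a -> psdmx A -> psdmx (a *: A).
Proof.
move=> a0 [At A0]; split; first by rewrite linearZ /= At.
by move=> x; rewrite -scalemxAr -scalemxAl mxE mulr_ge0.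
Qed.

Lemma psdmx_congr m n (B : 'M[R]_(m, n)) (A : 'M[R]_m) :
  psdmx A -> psdmx (B^T *m A *m B).
Proof.
move=> [At A0]; split; first by rewrite !trmx_mul trmxK At mulmxA.
by move=> x; have := A0 (B *m x); rewrite trmx_mul !mulmxA.
Qed.

Lemma psdmx1 n : psdmx (1%:M : 'M[R]_n).
Proof.
split=> [|x]; first exact: trmx1.
by rewrite mulmx1 mxE sumr_ge0 // => i _; rewrite mxE -expr2 sqr_ge0.
Qed.

Lemma psdmx_gram m n (B : 'M[R]_(m, n)) : psdmx (B^T *m B).
Proof. by have := psdmx_congr B (psdmx1 m); rewrite mulmx1. Qed.

(** The matrix is block diagonal with [m] copies of [A], so its quadratic form is a sum of forms of
    [A], one for each slice of [x]. *)
Lemma psdmx_tens1 m n (A : 'M[R]_n) :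
  psdmx A -> psdmx (tensmx (1%:M : 'M_m) A).
Proof.
move=> [At A0]; split=> [|x]; first by rewrite trmx_tens trmx1 At.
rewrite quad_formE sum_mxtens_index sumr_ge0 // => i _.
have := A0 (\col_j x (mxtens_index (i, j)) 0); rewrite quad_formE.
congr (0 <= _); apply: eq_bigr => j _; rewrite sum_mxtens_index.
rewrite (bigD1 i) //= [X in _ + X]big1 ?addr0 => [|k /negPf ki].
  by apply: eq_bigr => k _; rewrite !tensmxE !mxE eqxx mul1r.
by rewrite big1 // => l _; rewrite tensmxE mxE eq_sym ki mul0r mulr0 mul0r.
Qed.

(** A congruence by [tensmx B 1] turns [tensmx 1 A] into this matrix. *)
Lemma psdmx_tens_gram k m n (B : 'M[R]_(k, m)) (A : 'M[R]_n) :
  psdmx A -> psdmx (tensmx (B^T *m B) A).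
Proof.
move=> /(psdmx_tens1 k) /(psdmx_congr (tensmx B (1%:M : 'M_n))).
by rewrite trmx_tens trmx1 !tensmx_mul mulmx1 mul1mx mulmx1.
Qed.

(** With constant row sums [d], the quadratic form is half the sum of [W i j * (x i - x j) ^+ 2]. *)
Lemma psdmx_laplacian n (W : 'M[R]_n) d :
    W^T = W -> (forall i j, 0 <= W i j) -> (forall i, \sum_j W i j = d) ->
  psdmx (d%:M - W).
Proof.
move=> Wt W0 Wd; split=> [|x]; first by rewrite linearB /= tr_scalar_mx Wt.
have WC i j : W j i = W i j by rewrite -{1}Wt mxE.
suff -> : (x^T *m (d%:M - W) *m x) 0 0
    = 2^-1 * \sum_i \sum_j W i j * (x i 0 - x j 0) ^+ 2.
  apply: mulr_ge0; first by rewrite invr_ge0.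
  by apply: sumr_ge0 => i _; apply: sumr_ge0 => j _; rewrite mulr_ge0 ?sqr_ge0.
have row1 : \sum_i \sum_j W i j * x i 0 ^+ 2 = \sum_i d * x i 0 ^+ 2.
  by apply: eq_bigr => i _; rewrite -mulr_suml Wd.
have row2 : \sum_i \sum_j W i j * x j 0 ^+ 2 = \sum_i d * x i 0 ^+ 2.
  rewrite exchange_big -row1 /=.
  by apply: eq_bigr => i _; apply: eq_bigr => j _; rewrite WC.
rewrite mulmxBr mulmxBl mxE [X in _ + X]mxE.
have -> : (x^T *m d%:M *m x) 0 0 = \sum_i d * x i 0 ^+ 2.
  rewrite mul_mx_scalar -scalemxAl mxE mxE mulr_sumr.
  by apply: eq_bigr => i _; rewrite mxE expr2.
rewrite quad_formE.
have -> : \sum_i \sum_j W i j * (x i 0 - x j 0) ^+ 2 =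
    \sum_i \sum_j W i j * x i 0 ^+ 2 + \sum_i \sum_j W i j * x j 0 ^+ 2
    - 2 * \sum_i \sum_j x i 0 * W i j * x j 0.
  rewrite mulr_sumr -big_split -sumrB; apply: eq_bigr => i _ /=.
  rewrite mulr_sumr -big_split -sumrB; apply: eq_bigr => j _ /=.
  by ring.
by rewrite row1 row2; field.
Qed.

End PositiveSemidefinite.

(** * The cut metric and the semidefinite solution built on it *)

Section CutSolution.
Context {R : realType} (m : nat).
Hypothesis m_gt1 : (1 < m)%N.

Let n := (m + m)%N.
Let J : 'M[R]_n := all_ones n.

Definition cut_mx : 'M[R]_(m + m) := \matrix_(i, j) ((i < m)%N != (j < m)%N)%:R.

Lemma cut_mxE (i j : 'I_n) : cut_mx i j = ((i < m)%N != (j < m)%N)%:R.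
Proof. by rewrite mxE. Qed.

Lemma sum_cut_mx (i : 'I_n) : \sum_j cut_mx i j = m%:R.
Proof.
rewrite big_split_ord /=.
under eq_bigr do rewrite cut_mxE /= ltn_ord.
under [X in _ + X]eq_bigr do rewrite cut_mxE /= [X in _ != X]ltnNge leq_addr.
rewrite !sumr_const card_ord -mulrnDl -natrD.
by case: (i < m)%N; rewrite /= ?addn0 ?add0n.
Qed.

Lemma cut_mxC (i j : 'I_n) : cut_mx j i = cut_mx i j.
Proof. by rewrite !cut_mxE eq_sym. Qed.

Lemma cut_mx_bounds (i j : 'I_n) : 0 <= cut_mx i j <= 1.
Proof. by rewrite cut_mxE; case: (_ != _); rewrite /= ?lexx ler01. Qed.

Lemma cut_mx_diag (i : 'I_n) : cut_mx i i = 0.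
Proof. by rewrite cut_mxE eqxx. Qed.

Lemma cut_mx_idem (i j : 'I_n) : cut_mx i j * cut_mx i j = cut_mx i j.
Proof. by rewrite cut_mxE; case: (_ != _); rewrite /= ?mulr0 ?mulr1. Qed.

Lemma cut_mx_instance : tsp_instance cut_mx.
Proof.
split=> [|i j|i|i j k]; rewrite ?cut_mx_diag //.
- by apply/matrixP => i j; rewrite mxE cut_mxC.
- by case/andP: (cut_mx_bounds i j).
- rewrite !cut_mxE; case: (i < m)%N; case: (j < m)%N; case: (k < m)%N => //=;
    by rewrite -?natrD ler_nat.
Qed.

Let mxDE (A B : 'M[R]_(n * n)) a b : (A + B) a b = A a b + B a b.
Proof. exact: mxE. Qed.

Let mxZE c (A : 'M[R]_(n * n)) a b : (c *: A) a b = c * A a b.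
Proof. exact: mxE. Qed.

Let natm_neq0 : m%:R != 0 :> R.
Proof. by rewrite pnatr_eq0; case: m m_gt1. Qed.

Let natm_gt0 : 0 < m%:R :> R.
Proof. by rewrite ltr0n; case: m m_gt1. Qed.

Let natm1_gt0 : 0 < m%:R - 1 :> R.
Proof. by rewrite subr_gt0 ltr1n. Qed.

Let natn : n%:R = 2 * m%:R :> R.
Proof. by rewrite natrD -mulr2n mulr_natl. Qed.

Let P : 'M[R]_n := 1%:M - m%:R^-1 *: (J - cut_mx).

(** [J - cut_mx] consists of two diagonal all-ones blocks of size [m], so it squares to [m] times
    itself; hence [P] is symmetric and idempotent. *)
Lemma cut_proj_gram : P = P^T *m P.
Proof.
have KT : (J - cut_mx)^T = J - cut_mx.
  by apply/matrixP => i j; rewrite !mxE eq_sym.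
have KK : (J - cut_mx) *m (J - cut_mx) = m%:R *: (J - cut_mx).
  apply/matrixP => i j; rewrite !mxE.
  (* If [k] shares a cluster with both [i] and [j], then [i] and [j] share it too. This rewriting
     pulls the factor in [i], [j] out of the sum over [k]. *)
  transitivity (\sum_k (1 - cut_mx i j) * (1 - cut_mx j k)).
    apply: eq_bigr => k _; rewrite !mxE.
    by case: (i < m)%N; case: (j < m)%N; case: (k < m)%N => /=;
      rewrite ?subrr ?subr0 ?mulr0 ?mul0r.
  rewrite -mulr_sumr sumrB sum_cut_mx sumr_const card_ord natrD addrK.
  by rewrite cut_mxE mulrC.
have PT : P^T = P by rewrite /P linearB /= trmx1 linearZ /= KT.
rewrite PT [in RHS]/P mulmxBl mulmxBr mulmx1 mul1mx -scalemxAl -/P.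
rewrite /P mulmxBr mulmx1 -scalemxAr KK scalerA mulVf // scale1r subrr.
by rewrite scaler0 subr0.
Qed.

(** * Feasibility and cost for an abstract second factor [H] *)

Section Solution.
Variable H : 'M[R]_n.
Hypothesis HT : H^T = H.
Hypothesis H_diag : forall i, H i i = 0.
Hypothesis H_bounds : forall i j, 0 <= H i j <= 1.
Hypothesis H_sum : forall i, \sum_j H i j = m%:R.
Hypothesis H_psd : psdmx (J - 2 *: H).

Definition cut_sdp_sol : 'M[R]_(n * n) :=
  n%:R^-1 *: (tensmx 1%:M 1%:M
    + (m%:R - 1)^-1 *: tensmx (J - 1%:M - cut_mx) (J - 1%:M - H)
    + m%:R^-1 *: tensmx cut_mx H).

(** Reduces the trace constraints and the cost to traces of [n] by [n] matrices. *)
Lemma mxtrace_cut_sdp_sol A B : \tr (tensmx A B *m cut_sdp_sol) =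
  n%:R^-1 * (\tr A * \tr B
    + (m%:R - 1)^-1 * (\tr (A *m (J - 1%:M - cut_mx))
                       * \tr (B *m (J - 1%:M - H)))
    + m%:R^-1 * (\tr (A *m cut_mx) * \tr (B *m H))).
Proof.
rewrite -scalemxAr 2!mulmxDr -!scalemxAr mxtraceZ 2!mxtraceD !mxtraceZ.
by rewrite !tensmx_mul !mxtrace_tens !mulmx1.
Qed.

Let compl_diag (D : 'M[R]_n) i : D i i = 0 -> (J - 1%:M - D) i i = 0.
Proof. by move=> D0; rewrite !mxE eqxx D0 /= !subrr. Qed.

Let tr_diag0 (D : 'M[R]_n) : (forall i, D i i = 0) -> \tr D = 0.
Proof. by move=> D0; apply: big1. Qed.

Let mxtrace_J (D : 'M[R]_n) d :
  (forall i, \sum_j D i j = d) -> \tr (J *m D) = n%:R * d.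
Proof.
move=> Dd; rewrite mxtrace_mulC mxtrace_mulE.
under eq_bigr => i _ do under eq_bigr do rewrite mxE mulr1.
under eq_bigr do rewrite Dd.
by rewrite sumr_const card_ord mulr_natl.
Qed.

Let compl_sum (D : 'M[R]_n) i :
  \sum_j D i j = m%:R -> \sum_j (J - 1%:M - D) i j = m%:R - 1.
Proof.
move=> Dm; under eq_bigr do rewrite !mxE; rewrite !sumrB Dm.
rewrite sumr_const card_ord (bigD1 i) //= eqxx big1 => [|j /negPf ij].
  by rewrite natn /=; ring.
by rewrite eq_sym ij.
Qed.

Let compl_ge0 (D : 'M[R]_n) i j :
  (forall i, D i i = 0) -> (forall i j, 0 <= D i j <= 1) ->
  0 <= (J - 1%:M - D) i j.
Proof.
move=> D0 Db; rewrite !mxE; case: eqVneq => [->|ij] /=.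
  by rewrite D0 !subrr.
by rewrite subr0 subr_ge0; case/andP: (Db i j).
Qed.

Lemma cut_sdp_sol_ge0 a b : 0 <= cut_sdp_sol a b.
Proof.
case: (mxtens_indexP a) => i p; case: (mxtens_indexP b) => j q.
rewrite mxE; apply: mulr_ge0; first by rewrite invr_ge0 ler0n.
have -> : (tensmx 1%:M 1%:M
    + (m%:R - 1)^-1 *: tensmx (J - 1%:M - cut_mx) (J - 1%:M - H)
    + m%:R^-1 *: tensmx cut_mx H) (mxtens_index (i, p)) (mxtens_index (j, q))
  = 1%:M i j * 1%:M p q
    + (m%:R - 1)^-1 * ((J - 1%:M - cut_mx) i j * (J - 1%:M - H) p q)
    + m%:R^-1 * (cut_mx i j * H p q).
  by rewrite !mxDE !mxZE !tensmxE.
have Dij := cut_mx_bounds i j; have Hpq := H_bounds p q.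
apply: addr_ge0; first apply: addr_ge0.
- by rewrite !mxE mulr_ge0 ?ler0n.
- rewrite mulr_ge0 ?invr_ge0 ?(ltW natm1_gt0) // mulr_ge0 ?compl_ge0 //.
  + exact: cut_mx_diag.
  + exact: cut_mx_bounds.
- rewrite mulr_ge0 ?invr_ge0 ?(ltW natm_gt0) // mulr_ge0 //.
  + by case/andP: Dij.
  + by case/andP: Hpq.
Qed.

(* [J / n], [(J - 2 cut_mx) / n] and [P] are the orthogonal projections onto
   the constant vectors, the multiples of the cut vector and their orthogonal
   complement. *)
Lemma cut_sdp_sol_spectral : cut_sdp_sol =
  n%:R^-1 *: (n%:R^-1 *: tensmx J J
    + n%:R^-1 *: tensmx (J - 2 *: cut_mx) (J - 2 *: H)
    + (m%:R - 1)^-1 *: tensmx P (m%:R%:M - (J - H))).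
Proof.
congr (_ *: _); apply/matrixP => a b.
case: (mxtens_indexP a) => i p; case: (mxtens_indexP b) => j q.
rewrite !mxDE !mxZE !tensmxE.
have m1 := lt0r_neq0 natm1_gt0.
rewrite /P !mxE natn.
(* Entrywise, the claim is a rational identity in [m] and the entries of [cut_mx], [H] and the two
   identity matrices, so these become free variables. *)
move: (_ != _)%:R (H p q) => d h.
rewrite -[m%:R *+ _]mulr_natr.
move: ((i == j)%:R) ((p == q)%:R) => x y.
by field; rewrite m1 natm_neq0.
Qed.

Lemma cut_sdp_sol_psd : psdmx cut_sdp_sol.
Proof.
have J_gram : J = (const_mx 1 : 'rV_n)^T *m const_mx 1.
  by apply/matrixP => i j; rewrite !mxE big_ord1 !mxE mulr1.
have psdJ : psdmx J by rewrite J_gram; apply: psdmx_gram.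
have n0 : 0 <= n%:R^-1 :> R by rewrite invr_ge0.
rewrite cut_sdp_sol_spectral; apply/psdmxZ => //.
apply: psdmxD; first apply: psdmxD.
- apply/psdmxZ => //.
  by rewrite {1}J_gram; apply: psdmx_tens_gram.
- apply/psdmxZ => //.
  (* The cut vector: -1 on the first cluster, +1 on the second. *)
  pose s : 'rV[R]_n := \row_i (-1) ^+ (i < m)%N.
  suff -> : J - 2 *: cut_mx = s^T *m s by apply: psdmx_tens_gram.
  apply/matrixP => i j; rewrite [RHS]mxE big_ord1 !mxE.
  by case: (i < m)%N; case: (j < m)%N => /=; ring.
- apply: psdmxZ; first by rewrite invr_ge0 ltW.
  rewrite cut_proj_gram; apply/psdmx_tens_gram/psdmx_laplacian.
  + by apply/matrixP => i j; rewrite !mxE -{1}HT mxE.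
  + move=> i j; rewrite !mxE subr_ge0.
    by case/andP: (H_bounds i j).
  + move=> i; under eq_bigr do rewrite 3!mxE.
    by rewrite sumrB H_sum sumr_const card_ord natrD addrK.
Qed.

(** In the first three trace constraints, every product except those of the identity term with
    [delta_mx j j] contains the trace of a matrix with zero diagonal. *)
Lemma cut_sdp_sol_feasible : sdp1_feasible cut_sdp_sol.
Proof.
have n_neq0 : n%:R != 0 :> R by rewrite natn mulf_neq0 ?natm_neq0 ?pnatr_eq0.
have trc : \tr (J - 1%:M - cut_mx) = 0.
  by apply: tr_diag0 => i; apply: compl_diag; apply: cut_mx_diag.
have trh : \tr (J - 1%:M - H) = 0.
  by apply: tr_diag0 => i; apply: compl_diag.
have tr_cut : \tr cut_mx = 0 by apply: tr_diag0; apply: cut_mx_diag.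
have tr_H : \tr H = 0 by apply: tr_diag0.
have tr_del j : \tr (delta_mx j j : 'M[R]_n) = 1.
  by have := mxtrace_delta_mul (1%:M : 'M[R]_n) j; rewrite mulmx1 mxE eqxx.
have trJ1 : \tr (J - 1%:M) = 0 by apply: tr_diag0 => i; rewrite !mxE eqxx subrr.
have [YT Y0] := cut_sdp_sol_psd.
split; split=> //.
- exact: cut_sdp_sol_ge0.
- move=> j; rewrite mxtrace_cut_sdp_sol !mul1mx trc tr_cut mxtrace1 tr_del.
  by rewrite !(mul0r, mulr0, addr0) mulr1 mulVf.
- move=> j; rewrite mxtrace_cut_sdp_sol !mul1mx trh tr_H mxtrace1 tr_del.
  by rewrite !(mul0r, mulr0, addr0) mul1r mulVf.
- rewrite mulmxDl mxtraceD !mxtrace_cut_sdp_sol !mul1mx trc trh tr_cut tr_H.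
  by rewrite trJ1; ring.
- have -> : all_ones (n * n) = tensmx J J.
    by apply/matrixP => a b; rewrite !mxE mulr1.
  (* The three terms have row sums 1, [m - 1] and [m] in each factor, so the total is
     [n * (1 + (m - 1) + m) = n ^ 2]. *)
  rewrite mxtrace_cut_sdp_sol.
  rewrite (mxtrace_J sum_cut_mx) (mxtrace_J H_sum).
  rewrite (mxtrace_J (fun i => compl_sum (sum_cut_mx i))).
  rewrite (mxtrace_J (fun i => compl_sum (H_sum i))).
  have -> : \tr J = n%:R.
    rewrite /mxtrace; under eq_bigr do rewrite mxE.
    by rewrite sumr_const card_ord.
  by rewrite natrX natn; field; rewrite natm_neq0 lt0r_neq0.
Qed.

(** Only the [tensmx cut_mx H] term contributes: [cut_mx] has zero trace and its support is disjoint
    from that of [J - 1 - cut_mx]. The cost is thus half of [\tr (cycle_mx n *m H)]. *)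
Lemma cut_sdp_sol_cost k : (forall i, H i (ordS i) = k) ->
  sdp1_cost cut_mx cut_sdp_sol <= n%:R * k.
Proof.
move=> Hk; have HC i j : H j i = H i j by rewrite -{1}HT mxE.
(* The disjunction in [cycle_mx] is bounded by the sum of its two indicators, one for each
   orientation of the cycle; each contributes [n * k]. *)
have tr_cycle : \tr (cycle_mx n *m H) <= n%:R * k + n%:R * k.
  have kE : \sum_(i < n) k = n%:R * k by rewrite sumr_const card_ord mulr_natl.
  have {1}<- : \sum_i \sum_j (j == ordS i)%:R * H j i = n%:R * k.
    rewrite -kE; apply: eq_bigr => i _; rewrite (bigD1 (ordS i)) //=.
    rewrite eqxx mul1r HC Hk big1 ?addr0 // => j /negPf ->.
    by rewrite mul0r.
  have <- : \sum_i \sum_j (i == ordS j)%:R * H j i = n%:R * k.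
    rewrite exchange_big -kE; apply: eq_bigr => j _ /=.
    rewrite (bigD1 (ordS j)) //= eqxx mul1r Hk big1 ?addr0 // => i /negPf ->.
    by rewrite mul0r.
  rewrite mxtrace_mulE -big_split; apply: ler_sum => i _ /=.
  rewrite -big_split; apply: ler_sum => j _ /=.
  rewrite mxE -mulrDl ler_wpM2r //; first by case/andP: (H_bounds j i).
  by case: eqP; case: eqP => _ _ /=; rewrite ?addr0 ?add0r ?lerDl ?ler01.
have trcc : \tr (cut_mx *m cut_mx) = n%:R * m%:R.
  rewrite mxtrace_mulE.
  transitivity (\sum_(i < n) m%:R : R); last first.
    by rewrite sumr_const card_ord mulr_natl.
  apply: eq_bigr => i _; rewrite -(sum_cut_mx i); apply: eq_bigr => j _.
  by rewrite [cut_mx j i]cut_mxC cut_mx_idem.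
have trcn : \tr (cut_mx *m (J - 1%:M - cut_mx)) = 0.
  apply: mxtrace_mul_eq0 => i j; rewrite !mxE; case: (eqVneq j i) => [->|_].
    by rewrite eqxx mul0r.
  by case: (i < m)%N; case: (j < m)%N => /=; ring.
have n_neq0 : n%:R != 0 :> R by rewrite natn mulf_neq0 ?natm_neq0 ?pnatr_eq0.
rewrite /sdp1_cost mxtrace_cut_sdp_sol trcn trcc tr_diag0; last first.
  exact: cut_mx_diag.
rewrite !(mul0r, mulr0, add0r) -(mulrA n%:R) [m%:R^-1 * _]mulrCA mulKf //.
by rewrite mulKf //; lra.
Qed.

End Solution.
End CutSolution.

(** * A kernel on equally spaced points of the circle *)

Section CircularKernel.
Context {R : realType} (m : nat).
Hypothesis m_gt0 : (0 < m)%N.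

Let n := (m + m)%N.
Let h : R := pi / m%:R.

(** A quarter of the squared chord length between vertices [i] and [j] of the regular [2m]-gon in
    the unit circle. *)
Definition circ_mx : 'M[R]_(m + m) :=
  \matrix_(i, j) ((1 - cos ((i%:R - j%:R) * (pi / m%:R))) / 2).

Let m_h : m%:R * h = pi.
Proof. by rewrite /h mulrC divfK // pnatr_eq0 -lt0n. Qed.

Lemma circ_mxT : circ_mx^T = circ_mx.
Proof.
by apply/matrixP => i j; rewrite !mxE -[in LHS]cosN -mulNr opprB.
Qed.

Lemma circ_mx_diag (i : 'I_n) : circ_mx i i = 0.
Proof. by rewrite mxE subrr mul0r cos0 subrr mul0r. Qed.

Lemma circ_mx_bounds (i j : 'I_n) : 0 <= circ_mx i j <= 1.
Proof.
rewrite mxE; set x := _ * (pi / _).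
by have := cos_le1 x; have := cos_geN1 x; lra.
Qed.

(** The columns [j] and [m + j] are antipodal: their cosines cancel, so each of the [m] pairs
    contributes 1. *)
Lemma circ_mx_sum (i : 'I_n) : \sum_j circ_mx i j = m%:R.
Proof.
rewrite big_split_ord /= -big_split /=.
transitivity (\sum_(j < m) (1 : R)); last by rewrite sumr_const card_ord.
apply: eq_bigr => j _; rewrite !mxE /= natrD.
have -> : (i%:R - (m%:R + j%:R)) * (pi / m%:R) = (i%:R - j%:R) * h - pi :> R.
  by rewrite -/h -m_h; ring.
by rewrite cosB cospi sinpi -/h; lra.
Qed.

(** The entries are cosines of angle differences, so the addition formula gives a sum of two
    rank-one Gram matrices. *)
Lemma circ_mx_gram_psd : psdmx (all_ones n - 2 *: circ_mx).
Proof.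
pose c : 'rV[R]_n := \row_i cos (i%:R * h).
pose s : 'rV[R]_n := \row_i sin (i%:R * h).
suff -> : all_ones n - 2 *: circ_mx = c^T *m c + s^T *m s.
  by apply: psdmxD; apply: psdmx_gram.
apply/matrixP => i j; rewrite [RHS]mxE ![(_ *m _) _ _]mxE !big_ord1 !mxE.
by rewrite [(i%:R - _) * _]mulrBl cosB -/h; lra.
Qed.

Lemma circ_mx_ordS (i : 'I_n) :
  circ_mx i (ordS i) = (1 - cos (pi / m%:R)) / 2.
Proof.
rewrite mxE /= -/h; congr ((1 - _) / 2).
have [iSn|] := ltnP i.+1 n.
  by rewrite modn_small // -natr1 opprD addNKr mulN1r cosN.
(* At the wrap-around, [i + 1 = n] and the successor is 0; the angle [i * h] equals [- h] up to the
   full turn [n * h = 2 * pi]. *)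
rewrite leq_eqVlt ltnNge ltn_ord orbF => /eqP nE.
rewrite -nE modnn subr0 -[RHS]cosN -[RHS]cosD2pi; congr (cos _).
suff -> : pi = n%:R * h / 2 by rewrite nE -natr1; field.
by rewrite /n natrD mulrDl m_h; field.
Qed.

End CircularKernel.

(** * Bounds on the two optimal values *)

Section GapInstances.
Context {R : realType}.

Lemma sin_le_id (x : R) : 0 <= x -> sin x <= x.
Proof.
move=> x0; have [|c _] := @MVT_segment R sin cos 0 x x0.
- exact/continuous_subspaceT/continuous_sin.
- by rewrite sin0 !subr0 => ->; rewrite ler_piMl ?cos_le1.
Qed.

(** Follows from [1 - cos x = 2 * sin (x / 2) ^+ 2] and [sin y <= y] for [0 <= y]. *)
Lemma cos_ge_quadratic (x : R) : 1 - x ^+ 2 / 2 <= cos x.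
Proof.
wlog x0 : x / 0 <= x.
  move=> wl; have [/wl//|/ltW] := leP 0 x; rewrite -oppr_ge0 => /wl.
  by rewrite cosN sqrrN.
(* Beyond 2 the left side is at most -1. Otherwise [x / 2] lies in [[0, pi]], where the sine is
   nonnegative and its upper bound can be squared. *)
have [x2|x2] := leP x 2; last first.
  have : 2 ^+ 2 <= x ^+ 2 by rewrite lerXn2r ?nnegrE // ltW.
  by have := cos_geN1 x; lra.
have y0 : 0 <= x / 2 by rewrite divr_ge0.
have s0 : 0 <= sin (x / 2).
  by apply: sin_ge0_pi; rewrite y0 /=; have := @pi_ge2 R; lra.
have -> : cos x = 1 - 2 * sin (x / 2) ^+ 2.
  by rewrite sin2cos2 [in LHS](_ : x = (x / 2) *+ 2) ?cos_mulr2n; lra.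
have : sin (x / 2) ^+ 2 <= (x / 2) ^+ 2 by rewrite lerXn2r // sin_le_id.
by rewrite expr_div_n; lra.
Qed.

Lemma cut_mx_cycle_cost_ge1 m c : (0 < m)%N ->
  hamiltonian_cycle c -> 1 <= cycle_cost (@cut_mx R m) c.
Proof.
move=> m0 [/andP[_ uc] sc].
have c_all i : i \in c.
  have cE : #|c| = #|'I_(m + m)| by rewrite (card_uniqP uc) sc card_ord.
  by rewrite (subset_cardP cE (subset_predT _)).
have [i /andP[ic cross]|same] :=
  pickP (fun i : 'I_(m + m) => (i \in c) && ((i < m)%N != (next c i < m)%N)).
  rewrite /cycle_cost (bigD1_seq i) //= mxE cross lerDl sumr_ge0 // => j _.
  by rewrite mxE ler0n.
(* If no edge of the tour crosses the cut, transitivity puts all vertices on one side, which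
   vertices 0 and [m] contradict. *)
pose side_eq : rel 'I_(m + m) := fun i j => (i < m)%N == (j < m)%N.
have : cycle side_eq c.
  apply: cycle_from_next => // i ic.
  by have := same i; rewrite ic => /negbFE.
rewrite cycle_all2rel; last first.
  by move=> j i k /eqP ij /eqP jk; apply/eqP; rewrite ij.
have i0 : (0 < m + m)%N by rewrite addn_gt0 m0.
have im : (m < m + m)%N by rewrite -{1}[m]addn0 ltn_add2l.
move/allrelP/(_ (Ordinal i0) (Ordinal im) (c_all _) (c_all _)).
by rewrite /side_eq /= m0 ltnn.
Qed.

Lemma opt_tsp_cut_mx_ge1 m : (0 < m)%N -> (1 <= opt_tsp (@cut_mx R m))%E.
Proof.
move=> m0; apply/ereal_infP => _ [c cP <-].
by rewrite lee_fin cut_mx_cycle_cost_ge1.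
Qed.

Lemma sdp1_cost_ge0 n (D : 'M[R]_n) (Y : 'M_(n * n)) :
  tsp_instance D -> sdp1_feasible Y -> 0 <= sdp1_cost D Y.
Proof.
move=> [_ D0 _ _] [[_ Y0 _] _]; rewrite mulr_ge0 ?invr_ge0 //.
rewrite mxtrace_mulE; apply: sumr_ge0 => a _; apply: sumr_ge0 => b _.
by rewrite !mxE !mulr_ge0 ?ler0n.
Qed.

Lemma opt_sdp1_ge0 n (D : 'M[R]_n) : tsp_instance D -> (0 <= opt_sdp1 D)%E.
Proof.
move=> DP; apply/ereal_infP => _ [Y YP <-].
by rewrite lee_fin sdp1_cost_ge0.
Qed.

Lemma opt_sdp1_cut_mx_le m :
  (1 < m)%N -> (opt_sdp1 (@cut_mx R m) <= (8 / m%:R)%:E)%E.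
Proof.
move=> m1; have m0 : (0 < m)%N by apply: ltnW.
have mR : 0 < m%:R :> R by rewrite ltr0n.
have feas := cut_sdp_sol_feasible m1 (@circ_mxT R m) (@circ_mx_diag R m)
  (@circ_mx_bounds R m) (circ_mx_sum m0) (@circ_mx_gram_psd R m).
have cost := cut_sdp_sol_cost m1 (@circ_mxT R m) (@circ_mx_bounds R m)
  (circ_mx_ordS m0).
apply: le_trans (ereal_inf_lbound _) _.
  by exists (cut_sdp_sol (circ_mx m)).
rewrite lee_fin; apply: le_trans cost _.
have := cos_ge_quadratic (pi / m%:R : R).
(* The cost is at most [m * (1 - cos (pi / m))], hence at most [pi ^+ 2 / (2 * m)]; the crude bound
   [pi <= 4] yields the constant 8. *)
have : (pi : R) ^+ 2 <= 4 ^+ 2.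
  rewrite lerXn2r ?nnegrE ?pi_ge0 //.
  by have := @pihalf_lt2 R; lra.
rewrite natrD expr_div_n => pi4 cosq.
have : m%:R * (1 - cos (pi / m%:R)) <= m%:R * (pi ^+ 2 / m%:R ^+ 2 / 2) :> R.
  by rewrite ler_pM2l //; lra.
have -> : m%:R * (pi ^+ 2 / m%:R ^+ 2 / 2) = pi ^+ 2 / 2 / m%:R :> R.
  by field; rewrite gt_eqF.
have : pi ^+ 2 / 2 / m%:R <= 8 / m%:R :> R.
  by rewrite ler_pM2r ?invr_gt0 //; lra.
lra.
Qed.

Lemma ediv_ge_inv (t s : \bar R) e : 0 < e ->
  (1 <= t)%E -> (0 <= s <= e%:E)%E -> ((e^-1)%:E <= t / s)%E.
Proof.
move=> e0 t1 /andP[s0 se].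
have : ((e^-1)%:E <= s^-1)%E.
  case: s s0 se => [s||] //; rewrite !lee_fin => s0 se; rewrite inver.
  (* For [s = 0] the inverse is [+oo] and the bound is immediate. *)
  case: eqP => [_|/eqP sn0]; first exact: leey.
  by rewrite lee_fin lef_pV2 // posrE lt_def sn0.
move=> es; rewrite -[(e^-1)%:E]mul1e; apply: lee_pmul => //.
by rewrite lee_fin invr_ge0 ltW.
Qed.

End GapInstances.

Local Open Scope classical_set_scope.
Local Open Scope ring_scope.
Local Open Scope ereal_scope.

(* Division of extended reals satisfies 0^-1 = +oo, so the ratio of a positive
   number and zero is +oo. *)
Theorem corollary3p9 (R : realType) :
  ereal_sup [set r : \bar R | exists (n : nat) (D : 'M[R]_n),
    [/\ (3 <= n)%N, tsp_instance D, opt_tsp D != 0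
      & r = opt_tsp D / opt_sdp1 D]] = +oo.
Proof.
apply/eqyP => A A0.
(* The ratio is at least [m / 8], so [m] must exceed [8 * A]; the second successor also ensures
   [1 < m]. *)
pose m := (Num.truncn (8 * A)%R).+2.
have opt1 : 1 <= opt_tsp (@cut_mx R m) by exact: opt_tsp_cut_mx_ge1.
have sdp0 : 0 <= opt_sdp1 (@cut_mx R m) by apply/opt_sdp1_ge0/cut_mx_instance.
have sdpm : opt_sdp1 (@cut_mx R m) <= (8 / m%:R)%:E.
  exact: opt_sdp1_cut_mx_le.
apply: (@le_trans _ _ (opt_tsp (@cut_mx R m) / opt_sdp1 (@cut_mx R m))).
  have e0 : (0 < 8 / m%:R :> R)%R by rewrite divr_gt0.
  have sdp : 0 <= opt_sdp1 (@cut_mx R m) <= (8 / m%:R)%:E by rewrite sdp0.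
  apply: le_trans (ediv_ge_inv e0 opt1 sdp); rewrite lee_fin invf_div.
  rewrite ler_pdivlMr // mulrC; apply: (le_trans (ltW (truncnS_gt _))).
  by rewrite ler_nat.
apply: ereal_sup_ubound; exists (m + m)%N, (cut_mx m); split => //.
- by rewrite addnS.
- exact: cut_mx_instance.
- by rewrite gt_eqF // (lt_le_trans _ opt1) // lte01.
Qed.
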